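(* Let $K$ be a field, let $n$ be a positive integer, let $G$ be a group with identity element $e$, let $\rho$ be an equivalence relation on $\overline{n}=\{1,\ldots,n\}$, and put $S:=M_n(\rho,K)$ and $D:=\bigoplus_{i=1}^nKe_{i,i}$. The bijection $\Phi:\mathcal{G}(\rho,G,K)\to\mathcal{A}(\rho,G)$ induces a bijection between the set of graded $K$-algebra isomorphism classes of very good $G$-gradings on $S$ with $S_e=D$, and the set of equivalence classes of free partial actions of $G$ on $\overline{n}$ whose orbit equivalence relation is $\rho$.
   Context: Gradings. For $X,Y\subseteq\overline{n}\times\overline{n}$ put $XY=\{(i,k)\mid \exists j\in\overline{n}:\ (i,j)\in X,\ (j,k)\in Y\}$. A $G$-grading on $\rho$ is a family $(\rho_g)_{g\in G}$ of pairwise disjoint (possibly empty) subsets of $\rho$ with $\rho=\bigcup_{g\in G}\rho_g$ and $\rho_g\rho_h\subseteq\rho_{gh}$ for all $g,h\in G$. Let $e_{i,j}$ be the matrix with $1$ in position $(i,j)$ and zeros elsewhere, and $M_n(\rho,K)=\sum_{(i,j)\in\rho}Ke_{i,j}\subseteq M_n(K)$. A $G$-grading $(S_g)_{g\in G}$ on $S=M_n(\rho,K)$ is very good if there is a $G$-grading $(\rho_g)_{g\in G}$ on $\rho$ with $S_g=\sum_{(i,j)\in\rho_g}Ke_{i,j}$ for all $g\in G$. $\mathcal{G}(\rho,G,K)$ is the set of all very good $G$-gradings $(S_g)_{g\in G}$ on $S$ with $S_e=D$. Two gradings $(S_g)_{g\in G}$ and $(S'_g)_{g\in G}$ on $S$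 are graded isomorphic as $K$-algebras if there is a $K$-algebra automorphism $\phi:S\to S$ with $\phi(S_g)=S'_g$ for every $g\in G$. Partial actions. A partial action of $G$ on a set $X$ is a family $\alpha=(X_g,\alpha_g)_{g\in G}$, where $X_g\subseteq X$ and $\alpha_g:X_{g^{-1}}\to X_g$ is a bijection for every $g\in G$, such that (P1) $X_e=X$ and $\alpha_e=\mathrm{id}_X$; (P2) if $g,h\in G$, $x\in X_{h^{-1}}$ and $\alpha_h(x)\in X_{g^{-1}}$, then $x\in X_{(gh)^{-1}}$ and $\alpha_{gh}(x)=\alpha_g(\alpha_h(x))$. It is free if, whenever $x\in X_{g^{-1}}\cap X_{h^{-1}}$ and $\alpha_g(x)=\alpha_h(x)$, one has $g=h$. Its orbit equivalence relation is: $i\sim_\alpha j$ if and only if $\alpha_g(j)=i$ for some $g\in G$ with $j\in X_{g^{-1}}$. $\mathcal{A}(\rho,G)$ is the set of all free partial actions of $G$ on $\overline{n}$ whose orbit equivalence relation is $\rho$. Two partial actions $(X_g,\alpha_g)_{g\in G}$ on $X$ and $(Y_g,\beta_g)_{g\in G}$ on $Y$ are equivalent if there is a bijection $\sigma:X\to Y$ with $\sigma(X_g)=Y_g$ and $\sigma(\alpha_g(x))=\beta_g(\sigma(x))$ for all $g\in G$ and $x\in X_{g^{-1}}$. The bijection $\Phi$. For $\mathcal{S}=(S_g)_{g\in G}\in\mathcal{G}(\rho,G,K)$ and $g\in G$ put $\rho_g^{\mathcal{S}}=\{(i,j)\in\rho\mid e_{i,j}\in S_g\}$ and $X_g^{\mathcal{S}}=\{i\in\overline{n}\mid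 (i,j)\in\rho_g^{\mathcal{S}}\text{ for some }j\in\overline{n}\}$, and let $\alpha_g^{\mathcal{S}}:X_{g^{-1}}^{\mathcal{S}}\to X_g^{\mathcal{S}}$ be given by $\alpha_g^{\mathcal{S}}(j)=i\Leftrightarrow(i,j)\in\rho_g^{\mathcal{S}}$; then $\Phi(\mathcal{S}):=(X_g^{\mathcal{S}},\alpha_g^{\mathcal{S}})_{g\in G}$. The map $\Phi$ is a bijection with inverse sending $(X_g,\alpha_g)_{g\in G}$ to the grading with components $\bigoplus_{j\in X_{g^{-1}}}Ke_{\alpha_g(j),j}$. *)

(* Defs.v *)
From HB Require Import structures.
From mathcomp Require Import all_boot all_order all_algebra.
From mathcomp Require Import boolp classical_sets functions.

Set Implicit Arguments.
Unset Strict Implicit.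
Unset Printing Implicit Defensive.

Import GRing.Theory.
Local Open Scope classical_set_scope.
Local Open Scope ring_scope.

Definition eq_class (T : Type) (A : set T) (R : T -> T -> Prop) (x : T) :
    set T :=
  [set y | A y /\ R x y].

Definition eq_classes (T : Type) (A : set T) (R : T -> T -> Prop) :
    set (set T) :=
  [set eq_class A R x | x in A].

Section Gradings.
Variables (K : fieldType) (G : groupType) (n : nat).
Implicit Types (X Y rho : {set 'I_n * 'I_n}).

Definition pair_comp X Y : {set 'I_n * 'I_n} :=
  [set p | [exists j, ((p.1, j) \in X) && ((j, p.2) \in Y)]]%SET.

Definition rel_grading rho (r : G -> {set 'I_n * 'I_n}) : Prop :=
  [/\ forall g, r g \subset rho,
      forall g h, g <> h -> (r g :&: r h)%SET = finset.set0,
      forall p, p \in rho -> exists g, p \in r g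
    & forall g h, pair_comp (r g) (r h) \subset r (g * h)%g].

Definition span_units X : {vspace 'M[K]_n} :=
  (\sum_(p in X) <[delta_mx p.1 p.2]>)%VS.

Definition structural_algebra rho : {vspace 'M[K]_n} := span_units rho.

Definition diagonal_algebra : {vspace 'M[K]_n} :=
  (\sum_(i < n) <[delta_mx i i]>)%VS.

(* G may be infinite, so "A is the internal direct sum of the S g" is        *)
(* expressed through sums over finite duplicate-free lists of elements of G. *)
Definition alg_grading (A : {vspace 'M[K]_n}) (S : G -> {vspace 'M[K]_n}) :
    Prop :=
  [/\ forall g, (S g <= A)%VS,
      forall x, x \in A -> exists s : seq G, x \in (\sum_(g <- s) S g)%VS,
      forall (s : seq G) (v : G -> 'M[K]_n), uniq s ->
        (forall g, v g \in S g) -> \sum_(g <- s) v g = 0 ->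
        forall g, g \in s -> v g = 0
    & forall g h x y, x \in S g -> y \in S h -> x *m y \in S (g * h)%g].

Definition very_good rho (S : G -> {vspace 'M[K]_n}) : Prop :=
  exists2 r : G -> {set 'I_n * 'I_n},
    rel_grading rho r & forall g, S g = span_units (r g).

Definition very_good_gradings rho : set (G -> {vspace 'M[K]_n}) :=
  [set S | [/\ alg_grading (structural_algebra rho) S,
               very_good rho S
             & S 1%g = diagonal_algebra]].

(* A map A -> A is encoded by a function on all matrices, of which only the  *)
(* values on A matter.                                                       *)
Definition alg_automorphism (A : {vspace 'M[K]_n}) (phi : 'M[K]_n -> 'M[K]_n) :
    Prop :=
  [/\ set_bij [set` A] [set` A] phi,
      forall c : K, {in A, {morph phi : x / c *: x}},
      {in A &, {morph phi : x y / x + y}},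
      {in A &, {morph phi : x y / x *m y}}
    & phi 1%:M = 1%:M].

Definition graded_isomorphic (A : {vspace 'M[K]_n})
    (S S' : G -> {vspace 'M[K]_n}) : Prop :=
  exists2 phi : 'M[K]_n -> 'M[K]_n,
    alg_automorphism A phi & forall g, phi @` [set` S g] = [set` S' g].

End Gradings.

(* The family (X_g, alpha_g)_g : the partial function alpha_g has domain     *)
(* X_{g^-1} and is encoded as an option-valued map, equal to None exactly    *)
(* off X_{g^-1} (first clause of is_partial_action). Thus two partial        *)
(* actions are equal iff they have the same X_g and the same alpha_g.        *)
Record pact_data (G : groupType) (T : finType) := PActData {
  pact_dom : G -> {set T};
  pact_map : G -> T -> option T
}.

Section PartialActions.
Variables (G : groupType) (T : finType).
Implicit Type a : pact_data G T.

Definition is_partial_action a : Prop :=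
  let X := pact_dom a in let alpha := pact_map a in
  [/\ forall g x, (alpha g x != None) = (x \in X (g^-1)%g),
      forall g,
        [/\ forall x y, alpha g x = Some y -> y \in X g,
            forall x x' y,
              alpha g x = Some y -> alpha g x' = Some y -> x = x'
          & forall y, y \in X g -> exists x, alpha g x = Some y],
      X 1%g = [set: T]%SET /\ (forall x, alpha 1%g x = Some x)
    & forall g h x y, x \in X (h^-1)%g -> alpha h x = Some y ->
        y \in X (g^-1)%g ->
        x \in X ((g * h)^-1)%g /\ alpha (g * h)%g x = alpha g y].

Definition is_free a : Prop :=
  forall g h x, x \in pact_dom a (g^-1)%g -> x \in pact_dom a (h^-1)%g ->
    pact_map a g x = pact_map a h x -> g = h.

Definition orbit_rel a (i j : T) : Prop :=
  exists2 g, j \in pact_dom a (g^-1)%g & pact_map a g j = Some i.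

Definition free_pacts (rho : {set T * T}) : set (pact_data G T) :=
  [set a | [/\ is_partial_action a, is_free a
             & forall i j, (i, j) \in rho <-> orbit_rel a i j]].

End PartialActions.

Definition pact_equivalent (G : groupType) (T T' : finType)
    (a : pact_data G T) (b : pact_data G T') : Prop :=
  exists2 sigma : T -> T', bijective sigma &
    forall g, [set sigma x | x in pact_dom a g]%SET = pact_dom b g /\
      (forall x, x \in pact_dom a (g^-1)%g ->
        pact_map b g (sigma x) = omap sigma (pact_map a g x)).

Section Phi.
Variables (K : fieldType) (G : groupType) (n : nat).
Variable rho : {set 'I_n * 'I_n}.
Variable S : G -> {vspace 'M[K]_n}.

Definition support_rel (g : G) : {set 'I_n * 'I_n} :=
  [set p in rho | delta_mx p.1 p.2 \in S g]%SET.

(* For S in very_good_gradings rho, each j has at most one i with            *)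
(* (i, j) \in support_rel g, so the pick below is the unique such i.         *)
Definition Phi : pact_data G 'I_n :=
  PActData
    (fun g => [set i | [exists j, (i, j) \in support_rel g]]%SET)
    (fun g j => [pick i | (i, j) \in support_rel g]).

End Phi.

(* Main.v *)
Require Import Defs.
From HB Require Import structures.
From mathcomp Require Import all_boot all_order all_algebra.
From mathcomp Require Import boolp classical_sets functions.

Set Implicit Arguments.
Unset Strict Implicit.
Unset Printing Implicit Defensive.

(* A very good grading is determined by the sets of positions of its matrix
   units, and Phi reads these sets as the graphs of a partial action.  A
   bijection sigma carrying one family of position sets to the other permutes
   the matrix units, hence induces a graded automorphism.  Conversely a graded
   automorphism phi preserves the diagonal S_e, so it permutes the supports of
   the orthogonal idempotents e_ii and yields a permutation sigma; since
   phi(e_ij) = phi(e_ii) phi(e_ij) phi(e_jj) is a nonzero multiple of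
   e_(sigma i, sigma j), sigma carries the position sets of S to those of S'. *)

(** * Maps between sets of equivalence classes *)

Section QuotientBijection.
Local Open Scope classical_set_scope.

(** [f] both preserves and reflects the relations, so on [A] the relation [R] is the pullback of
    [R']; every comparison of classes can therefore be made on the side of [R']. *)
Lemma eq_classes_bij (T U : Type) (A : set T) (B : set U)
    (R : T -> T -> Prop) (R' : U -> U -> Prop) (f : T -> U) :
    (forall u, R' u u) -> (forall u v, R' u v -> R' v u) ->
    (forall u v w, R' u v -> R' v w -> R' u w) ->
    set_fun A B f -> set_surj A B f ->
    (forall x y, A x -> A y -> R x y <-> R' (f x) (f y)) ->
  exists2 Psi : set T -> set U,
    (forall x, A x -> Psi (eq_class A R x) = eq_class B R' (f x))
  & set_bij (eq_classes A R) (eq_classes B R') Psi.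
Proof.
move=> R'xx R'sym R'trans fAB fsurj RR'.
(* Saturating the image of [C] under [R'] avoids choosing a representative of [C]. *)
pose Psi (C : set T) : set U := [set u | B u /\ exists2 x, C x & R' (f x) u].
have PsiE x : A x -> Psi (eq_class A R x) = eq_class B R' (f x).
  move=> Ax; apply/seteqP; split => u /=.
    case=> Bu [y [Ay Rxy] fyu]; split => //.
    by apply: R'trans fyu; apply/RR'.
  by case=> Bu fxu; split => //; exists x => //; split => //; apply/RR'.
exists Psi => //; split.
- by move=> _ [x Ax <-]; rewrite PsiE //; exists (f x) => //; apply: fAB.
- move=> _ _ /set_mem[x Ax <-] /set_mem[y Ay <-]; rewrite !PsiE // => fxy.
  have [_ fyx] : eq_class B R' (f y) (f x).
    by rewrite -fxy; split; [apply: fAB|apply: R'xx].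
  apply/seteqP; split => z [Az /(RR' _ _ _ Az) h]; split => //; apply/RR' => //.
    by apply: R'trans fyx _; apply: h.
  by apply: R'trans (R'sym _ _ fyx) _; apply: h.
- move=> _ [u Bu <-]; have [x Ax <-] := fsurj _ Bu.
  by exists (eq_class A R x); [exists x|rewrite PsiE].
Qed.

End QuotientBijection.

(** * Equivalence of partial actions *)

Section PartialActions.
Local Open Scope group_scope.

Lemma pact_equivalent_refl (G : groupType) (T : finType) (a : pact_data G T) :
  pact_equivalent a a.
Proof.
exists id; first by exists id.
move=> g; split=> [|x _]; first exact: finset.imset_id.
by case: (pact_map a g x).
Qed.

Lemma pact_equivalent_sym (G : groupType) (T T' : finType)
    (a : pact_data G T) (b : pact_data G T') :
  pact_equivalent a b -> pact_equivalent b a.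
Proof.
case=> sigma [tau sigmaK tauK] ab; exists tau; first by exists sigma.
move=> g; have [<- _] := ab g; split.
  rewrite -finset.imset_comp -[RHS]finset.imset_id.
  by apply: finset.eq_imset => x /=; rewrite sigmaK.
have [<- _] := ab g^-1; have [_ abg] := ab g.
move=> _ /imsetP[x ax ->]; rewrite sigmaK abg //.
by case: (pact_map a g x) => //= y; rewrite sigmaK.
Qed.

Lemma pact_equivalent_trans (G : groupType) (T T' T'' : finType)
    (a : pact_data G T) (b : pact_data G T') (c : pact_data G T'') :
  pact_equivalent a b -> pact_equivalent b c -> pact_equivalent a c.
Proof.
case=> sigma bsigma ab [tau btau bc]; exists (tau \o sigma).
  exact: bij_comp.
move=> g; have [abX abm] := ab g; have [bcX bcm] := bc g; split.
  by rewrite -bcX -abX -(finset.imset_comp tau sigma).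
move=> x ax; rewrite /= bcm; last first.
  by have [<- _] := ab g^-1; apply: finset.imset_f.
by rewrite abm //; case: (pact_map a g x).
Qed.

(** In a partial action, [pact_map a g] is defined exactly on the domain at [g^-1] and is onto the
    domain at [g]. The domains are thus determined by the maps, and only the graphs have to
    correspond. *)
Lemma pact_equivalentP (G : groupType) (T T' : finType)
    (a : pact_data G T) (b : pact_data G T') :
    is_partial_action a -> is_partial_action b ->
  pact_equivalent a b <->
  exists2 sigma : T -> T', bijective sigma &
    forall g i j, pact_map a g j = Some i <->
                  pact_map b g (sigma j) = Some (sigma i).
Proof.
case=> adom aX _ _ [bdom bX _ _]; split; case=> sigma bij ab.
  have inj := bij_inj bij.
  exists sigma => // g i j; have [_ abg] := ab g; have [abX _] := ab g^-1.
  split=> [aji|bji].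
    by rewrite abg ?aji // -adom aji.
  have aj : j \in pact_dom a g^-1.
    by rewrite -(finset.mem_imset _ _ inj) abX -bdom bji.
  move: bji; rewrite abg //; case: (pact_map a g j) => //= k [] /inj -> //.
have [tau sigmaK tauK] := bij.
exists sigma => // g; split; last first.
  move=> x; rewrite -adom; case E: (pact_map a g x) => [y|] // _.
  by rewrite /=; apply/ab.
apply/setP => y; apply/imsetP/idP => [[x + ->]|].
  have [_ _ surj] := aX g => /surj[z /ab].
  by have [bcod _ _] := bX g => /bcod.
have [_ _ surj] := bX g => /surj[z bzy]; exists (tau y); last by rewrite tauK.
have [acod _ _] := aX g; apply: (acod (tau z)).
by apply/ab; rewrite !tauK.
Qed.

End PartialActions.

(** * Spans of matrix units and very good gradings *)

Section Gradings.
Import GRing.Theory.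
Local Open Scope ring_scope.
Variables (K : fieldType) (n : nat).

(** Replaces a sum of lines by a condition on the support of the matrix, so that later arguments
    work entry by entry. *)
Lemma mem_span_units (X : {set 'I_n * 'I_n}) (M : 'M[K]_n) :
  M \in span_units K X <-> forall i j, M i j != 0 -> (i, j) \in X.
Proof.
split=> [/memv_sumP[v vX ->] i j|MX].
  rewrite summxE; apply: contraR => ijX; apply/eqP; apply: big1 => p pX.
  have /vlineP[c ->] := vX p pX; rewrite !mxE.
  case: p pX => k l klX /=; case: eqP => [ik|_] /=; last by rewrite mulr0.
  case: eqP => [jl|_] /=; last by rewrite mulr0.
  by rewrite ik jl klX in ijX.
rewrite [M]matrix_sum_delta; apply: memv_suml => i _; apply: memv_suml => j _.
have [->|/MX ijX] := eqVneq (M i j) 0; first by rewrite scale0r mem0v.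
apply: memvZ; apply: (subvP (sumv_sup (i, j) ijX (subvv _))).
exact: memv_line.
Qed.

Lemma mem_delta_span_units (X : {set 'I_n * 'I_n}) i j :
  (delta_mx i j \in span_units K X) = ((i, j) \in X).
Proof.
apply/idP/idP => [/mem_span_units|ijX]; first by apply; rewrite mxE !eqxx oner_neq0.
apply/mem_span_units => k l; rewrite mxE.
by case: andP => [[/eqP-> /eqP->]|] //=; rewrite eqxx.
Qed.

Lemma span_units_inj : injective (@span_units K n).
Proof.
by move=> X Y XY; apply/setP => -[i j]; rewrite -!mem_delta_span_units XY.
Qed.

Lemma diagonal_algebraE :
  diagonal_algebra K n = span_units K [set p | p.1 == p.2]%SET.
Proof.
apply/eqP; rewrite eqEsubv; apply/andP; split; apply/subv_sumP.
  move=> i _; rewrite -memvE mem_delta_span_units inE //=.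
case=> i j; rewrite inE /= => /eqP <-.
exact: (sumv_sup i).
Qed.

Variables (G : groupType) (rho : {set 'I_n * 'I_n}).
Implicit Types (r : G -> {set 'I_n * 'I_n}) (S : G -> {vspace 'M[K]_n}).

(** Makes the grading axioms on the algebra a consequence of those on [rho], so that a very good
    grading is governed by its position sets alone. *)
Lemma rel_grading_alg_grading r : rel_grading rho r ->
  alg_grading (structural_algebra K rho) (fun g => span_units K (r g)).
Proof.
case=> rsub rdisj rcover rmul; split.
- move=> g; apply/subvP => M /mem_span_units Mr.
  by apply/mem_span_units => i j /Mr; apply/fintype.subsetP/rsub.
(* [d] assigns to each position of [rho] its degree, with the junk value 1 elsewhere. The list of
   degrees below may have repetitions, which a sum of subspaces tolerates. *)
- have /choice[d dP] p : exists g, p \in rho -> p \in r g.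
    have [/rcover[g pg]|] := boolP (p \in rho); first by exists g.
    by exists 1%g.
  move=> M /mem_span_units Mrho; exists [seq d p | p <- enum rho].
  rewrite [M]matrix_sum_delta; apply: memv_suml => i _; apply: memv_suml => j _.
  have [->|/Mrho ijrho] := eqVneq (M i j) 0; first by rewrite scale0r mem0v.
  have ds : d (i, j) \in [seq d p | p <- enum rho].
    by apply: map_f; rewrite mem_enum.
  rewrite (big_rem _ ds) /=; apply: memvZ; apply: (subvP (addvSl _ _)).
  by rewrite mem_delta_span_units dP.
(* By disjointness, if [v g] is nonzero at (i, j), all other summands vanish there, so the sum has
   the same nonzero entry. *)
- move=> s v us vS sumv0 g gs; apply/matrixP => i j; rewrite mxE.
  apply/eqP/negPn/negP => vij; have ijg := (mem_span_units _ _).1 (vS g) i j vij.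
  move/eqP: vij; apply; move: sumv0 => /matrixP/(_ i j).
  rewrite summxE mxE (bigD1_seq g) //= big1 ?addr0 // => h hg.
  apply/eqP/negPn/negP => vij; have ijh := (mem_span_units _ _).1 (vS h) i j vij.
  move/eqP/rdisj: hg => /setP/(_ (i, j)).
  by rewrite !inE ijg ijh.
- move=> g h x y /mem_span_units xg /mem_span_units yh.
  apply/mem_span_units => i k; rewrite mxE => xy.
  have [j xyj] : exists j, x i j * y j k != 0.
    apply/existsP; apply: contraR xy; rewrite negb_exists => /forallP xy0.
    by apply/eqP; apply: big1 => j _; apply/eqP/negPn/xy0.
  have [xij yjk] : x i j != 0 /\ y j k != 0.
    by apply/andP; rewrite -negb_or -mulf_eq0.
  apply: (fintype.subsetP (rmul g h)); rewrite inE; apply/existsP; exists j.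
  by rewrite /= xg ?yh.
Qed.

(** The equality of functions allows [S] to be substituted away; from here on gradings are handled
    through [r]. *)
Lemma very_good_gradingsP S : very_good_gradings rho S <->
  exists r, [/\ rel_grading rho r, r 1%g = [set p | p.1 == p.2]%SET
              & S = fun g => span_units K (r g)].
Proof.
split=> [[_ [r rg Sr] S1]|[r [rg r1 ->]]].
  exists r; split=> //; last exact: funext.
  by apply: span_units_inj; rewrite -Sr S1 diagonal_algebraE.
split; [exact: rel_grading_alg_grading|by exists r|].
by rewrite diagonal_algebraE r1.
Qed.

Lemma support_rel_span_units r g : rel_grading rho r ->
  support_rel rho (fun h => span_units K (r h)) g = r g.
Proof.
case=> rsub _ _ _; apply/setP => -[i j].
rewrite inE /= mem_delta_span_units andb_idl //.
exact/fintype.subsetP/rsub.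
Qed.

End Gradings.

(** * Position sets as graphs of free partial actions *)

Section GradedIsomorphisms.
Import GRing.Theory.
Local Open Scope ring_scope.
Variables (K : fieldType) (n : nat) (G : groupType) (rho : {set 'I_n * 'I_n}).
Hypothesis rho_equiv : equivalence_rel (fun i j : 'I_n => (i, j) \in rho).
Implicit Types (r : G -> {set 'I_n * 'I_n}).

Let rho_refl i : (i, i) \in rho.
Proof. by have [-> _] := rho_equiv i i i. Qed.

Let rho_sym i j : (i, j) \in rho -> (j, i) \in rho.
Proof.
by move=> ij; have [_ /(_ ij)] := rho_equiv i j i; rewrite rho_refl => <-.
Qed.

Lemma rel_grading_mul r g h i j k : rel_grading rho r ->
  (i, j) \in r g -> (j, k) \in r h -> (i, k) \in r (g * h)%g.
Proof.
case=> _ _ _ rmul ij jk; apply: (fintype.subsetP (rmul g h)).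
by rewrite inE; apply/existsP; exists j; rewrite ij.
Qed.

Lemma rel_grading_uniq r g h p : rel_grading rho r ->
  p \in r g -> p \in r h -> g = h.
Proof.
case=> _ rdisj _ _ pg ph; apply: contrapT => /rdisj/setP/(_ p).
by rewrite !inE pg ph.
Qed.

(** By symmetry of [rho], (j, i) has some degree h. Then (i, i) has degree gh as well as 1, whence
    gh = 1. *)
Lemma rel_grading_inv r g i j : rel_grading rho r ->
    r 1%g = [set p | p.1 == p.2]%SET ->
  (i, j) \in r g -> (j, i) \in r g^-1%g.
Proof.
move=> rg r1 ij; have [rsub _ rcover _] := rg.
have /rcover[h ji] := rho_sym (fintype.subsetP (rsub g) _ ij).
have ii1 : (i, i) \in r 1%g by rewrite r1 inE.
by rewrite (mulg1_eq (rel_grading_uniq rg (rel_grading_mul rg ij ji) ii1)).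
Qed.

(** Composing (i, j) with (j, i') gives (i, i') in degree 1, which is the diagonal. This makes each
    [r g] the graph of a partial function. *)
Lemma rel_grading_functional r g i i' j : rel_grading rho r ->
    r 1%g = [set p | p.1 == p.2]%SET ->
  (i, j) \in r g -> (i', j) \in r g -> i = i'.
Proof.
move=> rg r1 ij /(rel_grading_inv rg r1) ji'.
have := rel_grading_mul rg ij ji'.
by rewrite mulgV r1 inE => /eqP.
Qed.

Lemma pact_map_Phi r g i j : rel_grading rho r ->
    r 1%g = [set p | p.1 == p.2]%SET ->
  pact_map (Phi rho (fun h => span_units K (r h))) g j = Some i <->
  (i, j) \in r g.
Proof.
move=> rg r1; rewrite /=; case: pickP => [k|no].
  rewrite support_rel_span_units // => kj; split=> [[<-] //|ij].
  by rewrite (rel_grading_functional rg r1 ij kj).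
by split=> // ij; have := no i; rewrite support_rel_span_units // ij.
Qed.

Lemma pact_dom_Phi r g i : rel_grading rho r ->
  i \in pact_dom (Phi rho (fun h => span_units K (r h))) g <->
  exists j, (i, j) \in r g.
Proof.
move=> rg; rewrite /= inE; split=> [/existsP[j]|[j ij]].
  by rewrite support_rel_span_units //; exists j.
by apply/existsP; exists j; rewrite support_rel_span_units.
Qed.

Lemma pact_dom_Phi_inv r g j : rel_grading rho r ->
    r 1%g = [set p | p.1 == p.2]%SET ->
  j \in pact_dom (Phi rho (fun h => span_units K (r h))) g^-1%g <->
  exists i, (i, j) \in r g.
Proof.
move=> rg r1.
split=> [/(pact_dom_Phi _ _ rg)[i /(rel_grading_inv rg r1)]|[i ij]].
  by rewrite invgK; exists i.
by apply/(pact_dom_Phi _ _ rg); exists i; apply: rel_grading_inv.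
Qed.

(** The axioms translate one by one: injectivity of the map at g is functionality of [r g^-1], (P2)
    is multiplicativity, freeness is disjointness, and the orbit relation is the union of the
    [r g]. *)
Lemma Phi_free_pacts (S : G -> {vspace 'M[K]_n}) :
  very_good_gradings rho S -> free_pacts rho (Phi rho S).
Proof.
move=> /very_good_gradingsP[r [rg r1 ->]]; have [rsub _ rcover _] := rg.
have mapP g i j := pact_map_Phi g i j rg r1.
have domP g i := pact_dom_Phi g i rg.
have domVP g j := pact_dom_Phi_inv g j rg r1.
set a := Phi _ _ in mapP domP domVP *; split; first split.
- move=> g x; apply/idP/idP => [|/domVP[y /mapP ->] //].
  case E: (pact_map a g x) => [y|] // _.
  by apply/domVP; exists y; apply/mapP.
- move=> g; split=> [x y /mapP yx|x x' y /mapP yx /mapP yx'|y /domP[x yx]].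
  + by apply/domP; exists x.
  + by apply: (@rel_grading_functional r g^-1%g _ _ y) => //;
      apply: rel_grading_inv.
  + by exists x; apply/mapP.
- split=> [|x]; last by apply/mapP; rewrite r1 inE.
  by apply/setP => x; rewrite [RHS]inE; apply/domP; exists x; rewrite r1 inE.
- move=> g h x y _ /mapP yx /domVP[z zy].
  have zx := rel_grading_mul rg zy yx.
  split; first by apply/domVP; exists z.
  by rewrite ((mapP _ _ _).2 zx) ((mapP _ _ _).2 zy).
- move=> g h x /domVP[y yx] _; rewrite ((mapP _ _ _).2 yx) => /esym/mapP.
  exact: rel_grading_uniq yx.
- move=> i j; split=> [/rcover[g ij]|[g _ /mapP]]; last exact/fintype.subsetP.
  by exists g; [apply/domVP; exists i|apply/mapP].
Qed.

Lemma Phi_surj (a : pact_data G 'I_n) : free_pacts rho a ->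
  exists2 S : G -> {vspace 'M[K]_n}, very_good_gradings rho S & Phi rho S = a.
Proof.
case=> -[adom aX [_ a1] aM] afree arho.
(* The graph of the map at g, with the value in first position, so that [pair_comp] matches
   composition of maps. *)
pose r g : {set 'I_n * 'I_n} := [set p | pact_map a g p.2 == Some p.1]%SET.
have rP g i j : (i, j) \in r g <-> pact_map a g j = Some i.
  by rewrite inE /=; split=> /eqP.
have domV g i j : (i, j) \in r g -> j \in pact_dom a g^-1%g.
  by move=> /rP aji; rewrite -adom aji.
have rg : rel_grading rho r.
  split.
  - move=> g; apply/fintype.subsetP => -[i j] ij.
    by apply/arho; exists g; [exact: domV ij|apply/rP].
  - move=> g h gh; apply/setP => -[i j]; rewrite finset.in_setI finset.in_set0.
    apply/negP => /andP[ijg ijh]; apply: gh; apply: (afree _ _ j).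
    + exact: domV ijg.
    + exact: domV ijh.
    + by rewrite ((rP _ _ _).1 ijg) ((rP _ _ _).1 ijh).
  - by case=> i j /arho[g _ /rP]; exists g.
  - move=> g h; apply/fintype.subsetP => -[i k].
    rewrite inE /= => /existsP[j /andP[ij jk]]; apply/rP.
    have [_ ->] := aM g h k j (domV _ _ _ jk) ((rP _ _ _).1 jk) (domV _ _ _ ij).
    exact/rP.
have r1 : r 1%g = [set p | p.1 == p.2]%SET.
  by apply/setP => -[i j]; rewrite !inE /= a1 eq_sym.
exists (fun g => span_units K (r g)).
  by apply/very_good_gradingsP; exists r.
(* The equality with [a] is checked field by field: each domain is recovered as the range of a
   partial map, and each map from its graph, including the points where it is [None]. *)
case: a adom aX a1 aM afree arho @r rP domV rg r1.
move=> X alpha adom aX a1 aM _ _ r rP domV rg r1; rewrite /Phi; congr PActData.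
  apply/funext => g; apply/setP => i.
  have [cod _ surj] := aX g.
  apply/idP/idP => [/(pact_dom_Phi _ _ rg)[j /rP/cod] //|/surj[j /rP ij]].
  by apply/(pact_dom_Phi _ _ rg); exists j.
apply/funext => g; apply/funext => j.
case E: (alpha g j) => [i|]; first exact/(pact_map_Phi _ _ _ rg r1)/rP.
case: pickP => // i; rewrite support_rel_span_units // => /rP /=.
by rewrite E.
Qed.

(** * Graded isomorphisms and permutations of indices *)

Lemma rel_grading_sub r r' (sigma : 'I_n -> 'I_n) : rel_grading rho r ->
    rel_grading rho r' ->
    (forall g i j, (i, j) \in r g -> (sigma i, sigma j) \in r' g) ->
  forall i j, (i, j) \in rho -> (sigma i, sigma j) \in rho.
Proof.
case=> _ _ rcover _ [rsub' _ _ _] rr' i j /rcover[g /rr'].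
exact/fintype.subsetP.
Qed.

(** An injective [sigma] acts injectively on the finite set [rho], hence onto it. So a pair whose
    image lies in [r' g] has itself some degree h, and disjointness of [r'] forces g = h. *)
Lemma rel_grading_homo_iff r r' (sigma : 'I_n -> 'I_n) : rel_grading rho r ->
    rel_grading rho r' -> injective sigma ->
    (forall g i j, (i, j) \in r g -> (sigma i, sigma j) \in r' g) ->
  forall g i j, (i, j) \in r g <-> (sigma i, sigma j) \in r' g.
Proof.
move=> rg rg' inj rr' g i j; split=> [/rr' //|sij'].
pose f p := (sigma p.1, sigma p.2).
have f_inj : injective f by move=> [? ?] [? ?] [/inj-> /inj->].
have frho : [set f p | p in rho]%SET = rho.
  apply/eqP; rewrite eqEcard card_imset // leqnn andbT.
  apply/fintype.subsetP => _ /imsetP[[k l] kl ->].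
  exact: (rel_grading_sub rg rg' rr').
have [rsub' _ _ _] := rg'; have [_ _ rcover _] := rg.
have /rcover[h ijh] : (i, j) \in rho.
  by rewrite -(finset.mem_imset _ _ f_inj) frho; apply: fintype.subsetP sij'.
by rewrite (rel_grading_uniq rg' sij' (rr' _ _ _ ijh)).
Qed.

Lemma graded_isomorphic_of_bij r r' (sigma : 'I_n -> 'I_n) :
    rel_grading rho r -> rel_grading rho r' -> bijective sigma ->
    (forall g i j, (i, j) \in r g <-> (sigma i, sigma j) \in r' g) ->
  graded_isomorphic (structural_algebra K rho)
    (fun g => span_units K (r g)) (fun g => span_units K (r' g)).
Proof.
move=> rg rg' [tau sigmaK tauK] rr'.
have rr'V g i j : (i, j) \in r' g -> (tau i, tau j) \in r g.
  by move=> ij; apply/rr'; rewrite !tauK.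
(* Conjugation by a permutation matrix, written as reindexing. It is [conj tau], with the inverse
   permutation, that sends e_ij to e_(sigma i, sigma j). *)
pose conj (s : 'I_n -> 'I_n) (M : 'M[K]_n) : 'M[K]_n :=
  \matrix_(i, j) M (s i) (s j).
have conjP (s t : 'I_n -> 'I_n) (X Y : {set 'I_n * 'I_n}) M : cancel s t ->
    (forall i j, (i, j) \in X -> (t i, t j) \in Y) ->
    M \in span_units K X -> conj s M \in span_units K Y.
  move=> sK XY /mem_span_units MX; apply/mem_span_units => i j.
  by rewrite mxE => /MX/XY; rewrite !sK.
have conjK s t : cancel s t -> cancel (conj t) (conj s).
  by move=> sK M; apply/matrixP => i j; rewrite !mxE !sK.
have rho_sigma := rel_grading_sub rg rg' (fun g i j => (rr' g i j).1).
have rho_tau := rel_grading_sub rg' rg rr'V.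
exists (conj tau); first split; first split.
- by move=> M; apply: conjP rho_sigma.
- by move=> M N _ _; apply: (can_inj (conjK _ _ sigmaK)).
- by move=> M MA; exists (conj sigma M); [apply: conjP rho_tau _|exact: conjK].
- by move=> c M _; apply/matrixP => i j; rewrite !mxE.
- by move=> M N _ _; apply/matrixP => i j; rewrite !mxE.
- move=> M N _ _; apply/matrixP => i k; rewrite !mxE.
  rewrite (reindex tau); last by exists sigma.
  by apply: eq_bigr => j _; rewrite !mxE.
- by apply/matrixP => i j; rewrite !mxE (can_eq tauK).
- move=> g; apply/seteqP; split=> [_ [M MS <-]|M MS] /=.
    by apply: conjP MS => // i j /rr'.
  by exists (conj sigma M); [apply: conjP MS; [|exact: rr'V]|exact: conjK].
Qed.

Lemma bij_of_graded_isomorphic r r' :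
    rel_grading rho r -> r 1%g = [set p | p.1 == p.2]%SET ->
    rel_grading rho r' -> r' 1%g = [set p | p.1 == p.2]%SET ->
    graded_isomorphic (structural_algebra K rho)
      (fun g => span_units K (r g)) (fun g => span_units K (r' g)) ->
  exists2 sigma : 'I_n -> 'I_n, bijective sigma &
    forall g i j, (i, j) \in r g <-> (sigma i, sigma j) \in r' g.
Proof.
move=> rg r1 rg' r1' [phi [[phiA phi_inj _] phiZ _ phiM _] phiS].
have in_r g i j : (i, j) \in r g -> (i, j) \in rho.
  by case: rg => rsub _ _ _; apply/fintype.subsetP.
have eA i j : (i, j) \in rho -> delta_mx i j \in structural_algebra K rho.
  by rewrite mem_delta_span_units.
have phi0 : phi 0 = 0 by have := phiZ 0 0 (mem0v _); rewrite !scale0r.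
have phi_neq0 i j : (i, j) \in rho -> phi (delta_mx i j) != 0.
  move=> ij; apply/eqP; rewrite -phi0 => /phi_inj.
  rewrite !inE => /(_ (eA _ _ ij) (mem0v _)) /matrixP/(_ i j)/eqP.
  by rewrite !mxE !eqxx oner_eq0.
have phi_r g i j : (i, j) \in r g -> phi (delta_mx i j) \in span_units K (r' g).
  move=> ij; have /seteqP[+ _] := phiS g; apply.
  by exists (delta_mx i j) => //=; rewrite mem_delta_span_units.
pose E i := phi (delta_mx i i).
(* [phi] maps degree 1 to degree 1, and both components are the diagonal. *)
have E_diag i k l : k != l -> E i k l = 0.
  move=> kl; have /phi_r/mem_span_units Ei : (i, i) \in r 1%g by rewrite r1 inE.
  apply/eqP/negPn/negP => /Ei; rewrite r1' inE /=.
  by apply/negP.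
have /choice[sigma sigmaP] i : exists k, E i k k != 0.
  apply: contrapT => noE; have /eqP := phi_neq0 _ _ (rho_refl i); apply.
  apply/matrixP => k l; rewrite [RHS]mxE.
  have [<-|kl] := eqVneq k l; last exact: E_diag.
  by apply/eqP/negPn/negP => Ekk; apply: noE; exists k.
have E_orth i j k : i != j -> E i k k * E j k k = 0.
  move=> ij; have : E i *m E j = 0.
    by rewrite -phiM ?eA // mul_delta_mx_0 // phi0.
  move/matrixP/(_ k k); rewrite !mxE (bigD1 k) //= big1 ?addr0 // => l lk.
  by rewrite (E_diag i) 1?eq_sym // mul0r.
have sigma_inj : injective sigma.
  move=> i j sij; apply/eqP/negPn/negP => /(E_orth _ _ (sigma i))/eqP.
  by rewrite mulf_eq0 (negPf (sigmaP i)) sij (negPf (sigmaP j)).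
have sigma_bij := injF_bij sigma_inj.
(* Since k = sigma (tau k), position k already supports [E (tau k)]; orthogonality leaves no other
   idempotent there. *)
have E_supp i k : E i k k != 0 -> k = sigma i.
  have [tau _ tauK] := sigma_bij; rewrite -(tauK k) => Eik.
  have [->//|/(E_orth _ _ (sigma (tau k)))/eqP] := eqVneq (tau k) i.
  by rewrite mulf_eq0 (negPf Eik) (negPf (sigmaP _)).
(* The counting argument supplies the converse, so only the forward inclusion remains. *)
exists sigma => //; apply: rel_grading_homo_iff => // g i j ij.
have ijrho := in_r _ _ _ ij.
set M := phi (delta_mx i j).
have /mem_span_units Mr : M \in span_units K (r' g) by apply: phi_r.
have MEE : M = E i *m M *m E j.
  by rewrite -!phiM ?mul_delta_mx ?eA.
(* As [E i] and [E j] are diagonal, the (k, l) entry of the triple product is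
   [E i k k * M k l * E j l l]. *)
have M_supp k l : M k l != 0 -> k = sigma i /\ l = sigma j.
  rewrite MEE mxE (bigD1 l) //= big1 ?addr0 => [|m ml]; last first.
    by rewrite (E_diag j) ?mulr0.
  rewrite mxE (bigD1 k) //= big1 ?addr0 => [|m mk]; last first.
    by rewrite (E_diag i) ?mul0r // eq_sym.
  rewrite !mulf_eq0 !negb_or => /andP[/andP[Ei _] Ej].
  by split; apply: E_supp.
(* [M] is nonzero and supported at (sigma i, sigma j) at most, so its entry there cannot vanish. *)
apply: Mr; apply/negP => /eqP Mij; have /eqP := phi_neq0 _ _ ijrho; apply.
apply/matrixP => k l; rewrite [RHS]mxE; apply/eqP/negPn/negP => Mkl.
by have [kE lE] := M_supp _ _ Mkl; rewrite kE lE -/M Mij eqxx in Mkl.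
Qed.

(** Both relations amount to a permutation of the indices that carries each [r g] onto [r' g]. *)
Lemma graded_isomorphic_Phi (S S' : G -> {vspace 'M[K]_n}) :
    very_good_gradings rho S -> very_good_gradings rho S' ->
  graded_isomorphic (structural_algebra K rho) S S' <->
  pact_equivalent (Phi rho S) (Phi rho S').
Proof.
move=> vS vS'; have [pS _ _] := Phi_free_pacts vS.
have [pS' _ _] := Phi_free_pacts vS'.
apply: iff_trans (iff_sym (pact_equivalentP pS pS')).
move: vS vS' {pS pS'} => /very_good_gradingsP[r [rg r1 ->]].
move=> /very_good_gradingsP[r' [rg' r1' ->]].
have mapP g i j := pact_map_Phi g i j rg r1.
have mapP' g i j := pact_map_Phi g i j rg' r1'.
split=> [/(bij_of_graded_isomorphic rg r1 rg' r1')|] [sigma bij rr'].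
  exists sigma => // g i j.
  exact: iff_trans (mapP _ _ _) (iff_trans (rr' _ _ _) (iff_sym (mapP' _ _ _))).
apply: (graded_isomorphic_of_bij rg rg' bij) => g i j.
exact: iff_trans (iff_sym (mapP _ _ _)) (iff_trans (rr' _ _ _) (mapP' _ _ _)).
Qed.

End GradedIsomorphisms.

Theorem theorem42 (K : fieldType) (n : nat) (n_gt0 : (0 < n)%N) (G : groupType)
    (rho : {set 'I_n * 'I_n})
    (rho_equiv : equivalence_rel (fun i j : 'I_n => (i, j) \in rho)) :
  exists2 Psi : set (G -> {vspace 'M[K]_n}) -> set (pact_data G 'I_n),
    (forall S : G -> {vspace 'M[K]_n},
       very_good_gradings rho S ->
       Psi (eq_class (very_good_gradings rho)
                     (graded_isomorphic (structural_algebra K rho)) S)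
       = eq_class (free_pacts rho) (@pact_equivalent G 'I_n 'I_n) (Phi rho S))
  & set_bij
      (eq_classes (very_good_gradings rho)
                  (graded_isomorphic (structural_algebra K rho)))
      (eq_classes (free_pacts rho) (@pact_equivalent G 'I_n 'I_n))
      Psi.
Proof.
apply: eq_classes_bij.
- exact: pact_equivalent_refl.
- exact: pact_equivalent_sym.
- exact: pact_equivalent_trans.
- exact: Phi_free_pacts rho_equiv.
- by move=> a /(Phi_surj K rho_equiv)[S]; exists S.
- exact: graded_isomorphic_Phi rho_equiv.
Qed.
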